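(* Let $\mathcal{A}$ be a Banach algebra such that $\mathrm{rad}(\mathcal{A})=\mathrm{rann}(\mathcal{A})$ and $\mathcal{A}/\mathrm{rad}(\mathcal{A})$ is commutative, and suppose $\mathcal{A}$ has a right identity. Let $(\delta,d)$ be a generalized derivation of $\mathcal{A}$. Then the following are equivalent: (i) $\delta(\mathcal{A})\subseteq\mathrm{rad}(\mathcal{A})$; (ii) $\delta$ is spectrally infinitesimal; (iii) $\delta=d$.
   Context: $\mathrm{rad}(\mathcal{A})$ is the Jacobson radical and $\mathrm{rann}(\mathcal{A})=\{c\in\mathcal{A}: ac=0\ \forall a\in\mathcal{A}\}$. A derivation is a linear map $d:\mathcal{A}\to\mathcal{A}$ with $d(ab)=d(a)b+ad(b)$. A generalized derivation $(\delta,d)$ is a pair where $d$ is a derivation and $\delta:\mathcal{A}\to\mathcal{A}$ is linear with $\delta(ab)=a\delta(b)+d(a)b$ for all $a,b$. A linear map $T$ is spectrally infinitesimal if $r(T(a))=0$ for all $a\in\mathcal{A}$, $r$ the spectral radius. *)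

(* Defs.v *)
From mathcomp Require Import all_boot all_order all_algebra.
From mathcomp Require Import all_classical all_reals all_analysis.
From mathcomp Require Import complex.
Import Order.TTheory GRing.Theory Num.Theory.
Local Open Scope ring_scope.
Local Open Scope classical_set_scope.

Definition banach_algebra {R : realType} {A : completeNormedModType R[i]}
  (mul : A -> A -> A) : Prop :=
  (forall a b c, mul a (mul b c) = mul (mul a b) c) /\
  [/\
      (forall a b c, mul (a + b) c = mul a c + mul b c),
      (forall a b c, mul a (b + c) = mul a b + mul a c),
      (forall (k : R[i]) a b, mul (k *: a) b = k *: mul a b) &
      (forall (k : R[i]) a b, mul a (k *: b) = k *: mul a b)] /\
  (forall a b, `|mul a b| <= `|a| * `|b|).

Section Defs.
Context {R : realType} {A : completeNormedModType R[i]} (mul : A -> A -> A).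

Definition quasi_inverse (a b : A) : Prop :=
  a + b - mul a b = 0 /\ b + a - mul b a = 0.

Definition quasi_invertible (a : A) : Prop := exists b, quasi_inverse a b.

Definition jacobson_rad : set A :=
  [set a | forall b : A, quasi_invertible (mul b a)].

Definition rann : set A := [set c | forall a : A, mul a c = 0].

(* spectrum of a in the (possibly non-unital) algebra A, i.e. the spectrum
   in the unitization: 0 together with the nonzero lambda such that
   lambda^-1 a is not quasi-invertible. *)
Definition spectrum (a : A) : set R[i] :=
  [set l | l = 0 \/ (l != 0 /\ ~ quasi_invertible (l^-1 *: a))].

Definition spectral_radius (a : A) : R :=
  sup [set complex.Re `|l| | l in spectrum a].

Definition is_derivation (d : A -> A) : Prop :=
  forall a b, d (mul a b) = mul (d a) b + mul a (d b).

Definition is_generalized_derivation (delta d : A -> A) : Prop :=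
  is_derivation d /\ forall a b, delta (mul a b) = mul a (delta b) + mul (d a) b.

Definition spectrally_infinitesimal (T : A -> A) : Prop :=
  forall a, spectral_radius (T a) = 0.

Definition has_right_identity : Prop := exists e : A, forall a, mul a e = a.

Definition quotient_by_rad_commutative : Prop :=
  forall a b : A, jacobson_rad (mul a b - mul b a).

End Defs.

(* Main.v *)
From HB Require Import structures.
Require Import Defs.
From mathcomp Require Import all_boot all_order all_algebra.
From mathcomp Require Import all_classical all_reals all_analysis.
From mathcomp Require Import complex.
From mathcomp Require Import separable ring lra.
Import Order.TTheory GRing.Theory Num.Theory.
Import numFieldNormedType.Exports.
Import Normc.
Local Open Scope ring_scope.
Local Open Scope classical_set_scope.

(** Let [e] be a right identity. Then [B = e A] is a commutative semisimple Banach
    algebra with unit [e], isomorphic to [A / rad A], and [x |-> e (d x)] is a derivation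
    [D] of [B]. Since [delta a = a (delta e) + d a], everything but (iii) => (i) follows
    from the fact that quasinilpotents of a commutative Banach algebra lie in the radical;
    (iii) => (i) is Johnson's theorem that [D = 0].

    Quasinilpotents are radical: averaging the resolvent over [2 ^ n]-th roots of unity
    replaces the usual complex analysis.

    [D = 0]: a gliding hump shows that each [s] in the separating space of [D] has finite
    spectrum, so that, by semisimplicity, [p s = 0] for a polynomial [p] with simple
    roots. Then [p' s * D s = 0] with [p' s] invertible, so [D] vanishes on the separating
    space, which is an ideal; this forces it to be zero. So [D] is bounded by the closed
    graph theorem, [D a] is quasinilpotent by the Kleinecke-Shirokov identity, and
    [D a = 0]. *)

(** * Real estimates and the modulus of a complex number *)

Section RealBounds.
Context {R : realType}.
Implicit Types c x : R.

Lemma exists_lt_expr2 c : exists n, c < 2 ^+ n.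
Proof.
exists (Num.trunc c).+1; apply: (lt_le_trans (truncnS_gt c)).
by rewrite -natrX ler_nat ltnW // ltn_expl.
Qed.

(** Sums of series enter below only through remainder bounds [c / 2 ^+ n]; identities about them
    reduce to this. *)
Lemma le0_of_le_half_pow x c : (forall n, x <= c / 2 ^+ n) -> x <= 0.
Proof.
move=> h; rewrite leNgt; apply/negP => x0.
have [n hn] := exists_lt_expr2 (c / x).
have := h n; rewrite ler_pdivlMr ?exprn_gt0 // => /(lt_le_trans _).
by move=> /(_ c); rewrite -ltr_pdivrMl // mulrC hn ltxx => /(_ isT).
Qed.

Lemma le0_of_le_eps x : (forall e, 0 < e -> x <= e) -> x <= 0.
Proof.
by move=> h; rewrite leNgt; apply/negP => x0; have := h (x / 2); lra.
Qed.

Lemma normc_ge0 (k : R[i]) : 0 <= normc k.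
Proof. by case: k => a b /=; exact: sqrtr_ge0. Qed.

Lemma normcR c : normc c%:C%C = `|c|.
Proof. by rewrite /= expr0n addr0 sqrtr_sqr. Qed.

Lemma normcX (k : R[i]) n : normc (k ^+ n) = normc k ^+ n.
Proof.
elim: n => [|n ih]; first by rewrite !expr0 normc1.
by rewrite !exprS normcM ih.
Qed.

Lemma normc_gt0 (k : R[i]) : k != 0 -> 0 < normc k.
Proof.
move=> k0; rewrite lt0r normc_ge0 andbT.
by apply: contra k0 => /eqP/eq0_normc ->.
Qed.

End RealBounds.

(* [nm_complete] asks for convergence of geometrically dominated series only, which
   is equivalent to completeness. *)
Record banach_norm {R : realType} {B : comAlgType R[i]} (nm : B -> R) : Prop := {
  nm_triangle : forall x y, nm (x + y) <= nm x + nm y;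
  nm_scale : forall (k : R[i]) x, nm (k *: x) = normc k * nm x;
  nm_mul : forall x y, nm (x * y) <= nm x * nm y;
  nm_definite : forall x, nm x = 0 -> x = 0;
  nm_complete : forall (u : nat -> B) c, (forall n, nm (u n) <= c / 2 ^+ n) ->
    exists l, forall n, nm (l - \sum_(i < n) u i) <= 2 * c / 2 ^+ n }.

Definition invertible {B : comNzRingType} (x : B) : Prop := exists y, x * y = 1.

Section InvertibleTheory.
Context {B : comNzRingType}.
Implicit Types x y : B.

Lemma invertibleM x y : invertible x -> invertible y -> invertible (x * y).
Proof.
by move=> [x' hx] [y' hy]; exists (x' * y'); rewrite mulrACA hx hy mulr1.
Qed.

Lemma invertibleMl x y : invertible (x * y) -> invertible x.
Proof. by move=> [z hz]; exists (y * z); rewrite mulrA. Qed.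

End InvertibleTheory.

(** * Neumann series *)

Section BanachAlgebra.
Context {R : realType} {B : comAlgType R[i]} {nm : B -> R}.
Hypothesis bn : banach_norm nm.
Implicit Types (x y z a b : B) (k l : R[i]) (r c : R).

Lemma nm0 : nm 0 = 0.
Proof. by rewrite -(scale0r 0) (nm_scale _ bn) normc0 mul0r. Qed.

Lemma nmN x : nm (- x) = nm x.
Proof. by rewrite -scaleN1r (nm_scale _ bn) normcN normc1 mul1r. Qed.

Lemma nmB x y : nm (x - y) <= nm x + nm y.
Proof. by rewrite -(nmN y) (nm_triangle _ bn). Qed.

Lemma nm_distC x y : nm (x - y) = nm (y - x).
Proof. by rewrite -nmN opprB. Qed.

Lemma nm_ge0 x : 0 <= nm x.
Proof. by have := nmB x x; rewrite subrr nm0; lra. Qed.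

Lemma nm_le0 x : nm x <= 0 -> x = 0.
Proof. by move=> h; apply: (nm_definite _ bn); apply/eqP; rewrite eq_le h nm_ge0. Qed.

Lemma nm1_ge1 : 1 <= nm 1.
Proof.
have := nm_mul _ bn 1 1; rewrite mulr1 => h.
have [n0|n0] := eqVneq (nm 1) 0.
  by have /eqP := nm_definite _ bn _ n0; rewrite oner_eq0.
by have := nm_ge0 1; nra.
Qed.

Lemma nmX x n : nm (x ^+ n) <= nm 1 * nm x ^+ n.
Proof.
elim: n => [|n ih]; first by rewrite !expr0 mulr1.
rewrite !exprS; apply: (le_trans (nm_mul _ bn _ _)).
by rewrite mulrCA ler_wpM2l ?nm_ge0.
Qed.

Lemma nmXS x n : nm (x ^+ n.+1) <= nm x ^+ n.+1.
Proof.
elim: n => [|n ih]; first by rewrite !expr1.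
rewrite exprS [leRHS]exprS; apply: (le_trans (nm_mul _ bn _ _)).
by rewrite ler_wpM2l ?nm_ge0.
Qed.

(** The geometric series is the inverse. The norm of the unit is not normalised, hence the factor
    [nm 1]. *)
Lemma neumann x : nm x <= 2^-1 -> exists y, (1 - x) * y = 1 /\ nm y <= 2 * nm 1.
Proof.
move=> hx.
have hu n : nm (x ^+ n) <= nm 1 / 2 ^+ n.
  apply: (le_trans (nmX x n)); rewrite ler_wpM2l ?nm_ge0 // -exprVn.
  by rewrite lerXn2r // nnegrE ?nm_ge0.
have [l hl] := nm_complete _ bn _ _ hu.
exists l; split; last by have := hl 0%N; rewrite big_ord0 subr0 expr0 divr1.
apply/eqP; rewrite -subr_eq0; apply/eqP/nm_le0.
apply: (@le0_of_le_half_pow _ _ (nm (1 - x) * (2 * nm 1) + nm 1)) => n.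
have -> : (1 - x) * l - 1 = (1 - x) * (l - \sum_(i < n) x ^+ i) - x ^+ n.
  have := subrX1 x n; set s := \sum_(i < n) _ => e.
  by rewrite mulrBr -(opprB x 1) mulNr mulNr -e; ring.
apply: (le_trans (nmB _ _)); rewrite [leRHS]mulrDl; apply: lerD; last exact: hu.
apply: (le_trans (nm_mul _ bn _ _)); rewrite -mulrA.
by rewrite ler_wpM2l ?nm_ge0.
Qed.

Lemma invertible_near1 x : nm (1 - x) <= 2^-1 -> invertible x.
Proof.
by move=> /neumann[y [h _]]; exists y; rewrite -h; ring.
Qed.

End BanachAlgebra.

(** * Resolvents and quasinilpotent elements *)

Section SpectralRadius.
Context {R : realType} {B : comAlgType R[i]} {nm : B -> R}.
Hypothesis bn : banach_norm nm.
Implicit Types (x y z a b : B) (k l : R[i]) (r c t : R).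

Let has_inverse_le x M := exists y, x * y = 1 /\ nm y <= M.

(** If [f] inverts [1 - k0 *: a], then [(1 - k *: a) * f = 1 - (k - k0) *: (a * f)], which a Neumann
    series inverts for [k] near [k0]. *)
Lemma resolvent_locally_bounded a k0 : invertible (1 - k0 *: a) ->
  exists (e : {posnum R}) M, forall k, normc (k - k0) <= e%:num ->
    has_inverse_le (1 - k *: a) M.
Proof.
move=> [f hf].
have e0 : 0 < (2 * (nm a * nm f + 1))^-1.
  rewrite invr_gt0 mulr_gt0 // ltr_wpDl //.
  by apply: mulr_ge0; exact: (nm_ge0 bn).
exists (PosNum e0), (nm f * (2 * nm 1)) => k /= hk.
have [] := neumann bn ((k - k0) *: (a * f)).
  rewrite (nm_scale _ bn).
  have h1 := nm_mul _ bn a f; have h0 := nm_ge0 bn (a * f).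
  have ha := mulr_ge0 (nm_ge0 bn a) (nm_ge0 bn f).
  apply: (le_trans (ler_pM (normc_ge0 _) h0 hk h1)).
  rewrite invfM -mulrA ger_pMr ?invr_gt0 // mulrC ler_pdivrMr ?ltr_wpDl //.
  by rewrite mul1r lerDl.
move=> y [hy ny]; exists (f * y); split.
  rewrite mulrA -[RHS]hy; congr (_ * y).
  have e : f = 1 + k0 *: (a * f).
    by rewrite -[in RHS]hf mulrBl mul1r -scalerAl subrK.
  by rewrite mulrBl mul1r -scalerAl scalerBl {1}e; ring.
by apply: (le_trans (nm_mul _ bn _ _)); rewrite ler_wpM2l ?(nm_ge0 bn).
Qed.

(** In real coordinates the unit disc lies in a compact square, and compactness turns the local
    bounds into a single one. *)
Lemma resolvent_bounded a : (forall k, invertible (1 - k *: a)) ->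
  exists M, forall k, normc k <= 1 -> has_inverse_le (1 - k *: a) M.
Proof.
move=> ha.
pose Q (M : R) (p : R * R) := has_inverse_le (1 - Complex p.1 p.2 *: a) M.
have cpt : compact (`[(-1 : R), 1] `*` `[(-1 : R), 1]).
  by apply: compact_setX; exact: segment_compact.
have [M [_ hM]] : \forall M \near +oo, (`[(-1 : R), 1] `*` `[(-1 : R), 1]) `<=` Q M.
  apply: ((compact_near_coveringP _).1 cpt) => -[x0 y0] _.
  have [e [M hM]] := resolvent_locally_bounded a (Complex x0 y0) (ha _).
  exists (ball (x0, y0) (e%:num / 2), [set M' | M <= M']).
    by split=> /=; [apply: nbhsx_ballx|exists M; rewrite num_real; split=> // ? /ltW].
  move=> [[x y] M'] /= [[hx hy] hM'].
  have [|f [h1 h2]] := hM (Complex x y).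
    have : normc (Complex (x - x0) 0 + Complex 0 (y - y0)) <= e%:num.
      apply: (le_trans (le_normcD _ _)).
      move: hx hy; rewrite /ball /= => hx hy.
      rewrite !expr0n /= addr0 add0r !sqrtr_sqr (distrC x) (distrC y).
      by lra.
    by rewrite /= ?add0r ?addr0.
  by exists f; split => //; apply: (le_trans h2).
have h := hM (M + 1) _; rewrite ltrDl ltr01 in h.
exists (M + 1) => -[x y] hxy; apply: (h isT (x, y)).
have hx : `|x| <= 1.
  apply: le_trans hxy; rewrite /= -sqrtr_sqr ler_sqrt ?lerDl ?sqr_ge0 //.
  by rewrite addr_ge0 ?sqr_ge0.
have hy : `|y| <= 1.
  apply: le_trans hxy; rewrite /= -sqrtr_sqr ler_sqrt ?lerDr ?sqr_ge0 //.
  by rewrite addr_ge0 ?sqr_ge0.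
by split; rewrite /= in_itv /= -ler_norml.
Qed.


(** Multiplying [k] by such a [z] turns [(k *: a) ^+ (2 ^ n)] into its opposite without leaving the
    unit disc. *)
Lemma exists_rootN1 n : exists z : R[i], z ^+ (2 ^ n) = -1 /\ normc z = 1.
Proof.
have n0 : (0 < 2 ^ n)%N by rewrite expn_gt0.
exists ((2 ^ n).-root (-1)); have e := rootCK n0 (-1 : R[i]); split=> //.
have : normc ((2 ^ n).-root (-1 : R[i])) ^+ (2 ^ n) = 1.
  by rewrite -normcX e normcN normc1.
by move/eqP; rewrite pexpr_eq1 ?normc_ge0 // => /eqP.
Qed.

(* [(1 - z ^ 2)^-1] is the mean of [(1 - z)^-1] and [(1 + z)^-1]: hence
   [k |-> (1 - (k a)^(2 ^ n))^-1] is a mean of rotations of the resolvent, and is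
   radially Lipschitz on the unit disc with a constant independent of [n]. *)
Lemma resolvent_pow2_lipschitz a : (forall k, invertible (1 - k *: a)) ->
  exists L, 0 <= L /\ forall n k t, normc k <= 1 -> 0 <= t <= 1 ->
    exists y y', [/\ (1 - (k *: a) ^+ (2 ^ n)) * y = 1,
      (1 - ((t%:C%C * k) *: a) ^+ (2 ^ n)) * y' = 1 & nm (y - y') <= L * (1 - t)].
Proof.
move=> ha; have [M hM] := resolvent_bounded a ha.
have M0 : 0 <= M.
  have [|y [_ hy]] := hM 0; first by rewrite normc0.
  exact: le_trans (nm_ge0 bn y) hy.
exists (nm a * (M * M)); split; first by rewrite !mulr_ge0 ?(nm_ge0 bn).
elim=> [|n ih] k t hk /andP[t0 t1].
  have [y [hy ny]] := hM k hk.
  have [|y' [hy' ny']] := hM (t%:C%C * k).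
    by rewrite normcM normcR ger0_norm // mulr_ile1 ?normc_ge0.
  exists y, y'; rewrite expn0 !expr1; split => //.
  have -> : y - y' = (k - t%:C%C * k) *: (a * (y * y')).
    transitivity (y * y' * ((1 - (t%:C%C * k) *: a) - (1 - k *: a))).
      have -> (u u' : B) : y * y' * (u' - u) = y * (u' * y') - y' * (u * y) by ring.
      by rewrite hy hy' !mulr1.
    rewrite opprB addrC addrA subrK -scalerBl -scalerAr; congr (_ *: _).
    by rewrite mulrC.
  rewrite (nm_scale _ bn).
  have -> : k - t%:C%C * k = (1 - t)%:C%C * k by rewrite rmorphB rmorph1; ring.
  rewrite normcM normcR ger0_norm ?subr_ge0 //.
  have h1 := nm_mul _ bn a (y * y'); have h2 := nm_mul _ bn y y'.
  have h3 : nm y * nm y' <= M * M by rewrite ler_pM ?(nm_ge0 bn).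
  have h4 : nm a * nm (y * y') <= nm a * (M * M).
    by rewrite ler_wpM2l ?(nm_ge0 bn) //; apply: le_trans h3.
  rewrite mulrC; apply: ler_pM; rewrite ?(nm_ge0 bn) ?mulr_ge0 ?subr_ge0 ?normc_ge0 //.
    exact: le_trans h4.
  by rewrite ler_piMr ?subr_ge0.
have [z [hz nz]] := exists_rootN1 n.
have [y1 [y1' [h1 h1' n1]]] := ih k t hk (introT andP (conj t0 t1)).
have [|y2 [y2' [h2 h2' n2]]] := ih (z * k) t _ (introT andP (conj t0 t1)).
  by rewrite normcM nz mul1r.
have mean (u v w : B) : (1 - u) * v = 1 -> (1 + u) * w = 1 ->
    (1 - u ^+ 2) * (2^-1 *: (v + w)) = 1.
  move=> hv hw; rewrite -scalerAr.
  have -> : (1 - u ^+ 2) * (v + w) = (1 + u) * ((1 - u) * v) + (1 - u) * ((1 + u) * w).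
    by ring.
  rewrite hv hw !mulr1; have -> : 1 + u + (1 - u) = (2%:R : R[i]) *: 1 by rewrite scaler_nat; ring.
  by rewrite scalerA mulVf ?scale1r // pnatr_eq0.
exists (2^-1 *: (y1 + y2)), (2^-1 *: (y1' + y2')); split.
- rewrite expnS mulnC exprM; apply: mean => //.
  by move: h2; rewrite !exprZn exprMn hz mulN1r scaleNr opprK.
- rewrite expnS mulnC exprM; apply: mean => //.
  move: h2'; have -> : t%:C%C * (z * k) = z * (t%:C%C * k) by ring.
  by rewrite !exprZn (exprMn_comm _ (mulrC _ _)) hz mulN1r scaleNr opprK.
- rewrite -scalerBr (nm_scale _ bn).
  have -> : (2^-1 : R[i]) = (2^-1)%:C%C by rewrite fmorphV rmorph_nat.
  rewrite normcR ger0_norm ?invr_ge0 //.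
  have -> : y1 + y2 - (y1' + y2') = (y1 - y1') + (y2 - y2') by ring.
  have := nm_triangle _ bn (y1 - y1') (y2 - y2'); lra.
Qed.

Lemma exists_exprn_le (q e : R) : 0 <= q < 1 -> 0 < e ->
  exists m, forall n, (m <= n)%N -> q ^+ n <= e.
Proof.
move=> /andP[q0 q1] e0.
have : q ^+ n @[n --> \oo] --> 0 by apply: cvg_expr; rewrite ger0_norm.
move/cvgrPdist_le => /(_ e e0) [m _ hm]; exists m => n /hm /=.
by rewrite sub0r normrN ger0_norm ?exprn_ge0.
Qed.


(* If [(t a)^(2 ^ n)] is bounded, then [(1 - (q t a)^(2 ^ n))^-1] tends to [1], so by
   the uniform Lipschitz bound [(1 - (t a / q)^(2 ^ n))^-1] stays close to [1]: the
   bound propagates from [t] to [t / q] with a fixed [q < 1]. *)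
Lemma pow2_bounded a : (forall k, invertible (1 - k *: a)) ->
  exists m, forall n, (m <= n)%N -> nm (a ^+ (2 ^ n)) <= 1.
Proof.
move=> /resolvent_pow2_lipschitz[L [L0 hL]].
pose E t := exists m, forall n, (m <= n)%N -> nm ((t%:C%C *: a) ^+ (2 ^ n)) <= 1.
have N1 := nm1_ge1 bn.
have nmZX t n : 0 <= t -> nm ((t%:C%C *: a) ^+ n) = t ^+ n * nm (a ^+ n).
  by move=> t0; rewrite exprZn (nm_scale _ bn) normcX normcR ger0_norm.
(* An element within [eps] of [1] has an inverse of norm at most [2 * nm 1]; the product of the two
   bounds is [1], the bound to be propagated. *)
pose eps := (2 * nm 1)^-1.
have eps0 : 0 < eps by rewrite invr_gt0; lra.
have epsE : eps * (2 * nm 1) = 1 by rewrite mulVf //; lra.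
have eps2 : eps <= 2^-1 by nra.
(* Small enough that rescaling by [q ^+ 2] moves the inverse by at most [eps / 2]. *)
pose d := eps / (4 * (L + 1)).
have dE : d * (4 * (L + 1)) = eps by rewrite divfK //; lra.
have d0 : 0 < d by rewrite divr_gt0 //; lra.
have dL : 0 <= d * L by rewrite mulr_ge0 // ltW.
have dL2 : 0 <= d * L * d by rewrite mulr_ge0 // ltW.
pose q := 1 - d.
have q0 : 0 < q by rewrite /q; lra.
have q1 : q < 1 by rewrite /q; lra.
have Lq : L * (1 - q ^+ 2) <= eps / 2.
  have -> : L * (1 - q ^+ 2) = 2 * (d * L) - d * L * d by rewrite /q; ring.
  lra.
clearbody q.
have q01 : 0 <= q < 1 by rewrite ltW.
have e20 : 0 < eps * eps / 2 by rewrite divr_gt0 // mulr_gt0.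
have step t : 0 <= t -> E t -> E (Num.min 1 (t / q)).
  move=> t0 [m hm]; set t2 := Num.min 1 (t / q).
  have t20 : 0 <= t2 by rewrite le_min ler01 divr_ge0 // ltW.
  have t21 : t2 <= 1 by rewrite ge_min lexx.
  have t2q : q * t2 <= t.
    by rewrite mulrC -ler_pdivlMr // ge_min lexx orbT.
  have [m' hm'] := exists_exprn_le _ _ q01 e20.
  exists (maxn m m') => n; rewrite geq_max => /andP[/hm hn mn].
  have /hm' qn : (m' <= 2 ^ n)%N by rewrite (leq_trans mn) // ltnW // ltn_expl.
  (* One factor [q] brings [t2] back below [t], where powers are bounded; the other makes them tend
     to zero. The minimum with [1] keeps [t2] in the unit disc. *)
  have [||y [y' [hy hy' hyy]]] := hL n t2%:C%C (q ^+ 2).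
    by rewrite normcR ger0_norm.
    by rewrite exprn_ge0 ?exprn_ile1 // ltW.
  set z := (t2%:C%C *: a) ^+ (2 ^ n) in hy *.
  set z' := (_ *: a) ^+ (2 ^ n) in hy'.
  have nz' : nm z' <= eps * eps / 2.
    rewrite /z' -rmorphM nmZX ?mulr_ge0 ?exprn_ge0 ?(ltW q0) //.
    apply: le_trans qn; rewrite nmZX // in hn.
    have qt : (q ^+ 2 * t2) ^+ (2 ^ n) <= (q * t) ^+ (2 ^ n).
      have h : q ^+ 2 * t2 <= q * t by rewrite expr2 -mulrA ler_wpM2l // ltW.
      have h0 : 0 <= q ^+ 2 * t2 by rewrite mulr_ge0 // exprn_ge0 // ltW.
      by apply: lerXn2r => //; rewrite nnegrE // (le_trans h0).
    apply: (le_trans (ler_wpM2r (nm_ge0 bn _) qt)).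
    by rewrite exprMn -mulrA ler_piMr // exprn_ge0 // ltW.
  have [|w [hw nw]] := neumann bn z'; first by nra.
  have wy : y' = w.
    by rewrite -[y']mul1r -hw mulrAC hy' mul1r.
  have ny' : nm (1 - y') <= eps / 2.
    have -> : 1 - y' = - (z' * y') by rewrite -[1 in LHS]hy'; ring.
    rewrite nmN //; apply: (le_trans (nm_mul _ bn _ _)).
    rewrite -wy in nw.
    have := ler_pM (nm_ge0 bn _) (nm_ge0 bn _) nz' nw; nra.
  have ny : nm (1 - y) <= eps.
    have -> : 1 - y = (1 - y') - (y - y') by ring.
    have := nmB bn (1 - y') (y - y'); lra.
  have [|v [hv nv]] := neumann bn (1 - y); first by lra.
  rewrite opprB addrC subrK in hv.
  have vz : v = 1 - z by rewrite -[v]mul1r -[X in X * v]hy -mulrA hv mulr1.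
  have -> : z = - ((1 - y) * v) by rewrite mulrBl mul1r hv vz; ring.
  rewrite (nmN bn); apply: (le_trans (nm_mul _ bn _ _)).
  by have := ler_pM (nm_ge0 bn _) (nm_ge0 bn _) ny nv; rewrite epsE.
(* At [t0] the scaled element has norm at most [1]; after [m] steps with [q ^+ m <= t0] the scale
   [1] is reached. *)
pose t0 := (nm a + 1)^-1.
have a0 := nm_ge0 bn a.
have t00 : 0 < t0 by rewrite invr_gt0; lra.
have hE m : E (Num.min 1 (t0 / q ^+ m)).
  elim: m => [|m /step].
    exists 0%N => n _; have [n' ->] : exists n', (2 ^ n = n'.+1)%N.
      by exists (2 ^ n).-1; rewrite prednK // expn_gt0.
    apply: (le_trans (nmXS bn _ _)); apply: exprn_ile1; first exact: nm_ge0 bn _.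
    rewrite expr0 divr1 (nm_scale _ bn) normcR ger0_norm ?le_min ?ler01 ?(ltW t00) //.
    apply: (@le_trans _ _ (t0 * nm a)); first by rewrite ler_wpM2r // ge_min lexx orbT.
    by rewrite mulrC ler_pdivrMr ?mul1r; lra.
  rewrite le_min ler01 divr_ge0 ?exprn_ge0 ?(ltW q0) ?(ltW t00) // => /(_ isT).
  congr E; rewrite exprSr invfM mulrA.
  have q11 : 1 <= 1 / q by rewrite ler_pdivlMr ?mul1r // ltW.
  case: (leP 1 (t0 / q ^+ m)) => h.
    rewrite !min_l // (le_trans h) // ler_peMr ?divr_ge0 ?exprn_ge0 ?(ltW q0) ?(ltW t00) //.
    by rewrite -[q^-1]mul1r.
  by [].
have [m hm] := exists_exprn_le _ _ q01 t00.
have := hE m; rewrite min_l; last first.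
  by rewrite ler_pdivlMr ?exprn_gt0 // mul1r hm.
by move=> [m' hm']; exists m' => n /hm'; rewrite rmorph1 scale1r.
Qed.

(** Powers of [r *: a] stay bounded while those of [b / r] are small, so some [(b * a) ^+ (2 ^ m)]
    has norm at most one half; and [1 - b * a] divides [1 - (b * a) ^+ (2 ^ m)]. *)
Lemma quasinilpotent_radical a : (forall k, invertible (1 - k *: a)) ->
  forall b, invertible (1 - b * a).
Proof.
move=> ha b; pose r := 2 * (nm b + 1).
have b0 := nm_ge0 bn b.
have r0 : 0 < r by rewrite /r; lra.
have rC : r%:C%C != 0 :> R[i] by apply/eqP => -[]; lra.
have [k|m /(_ m (leqnn m)) hm] := pow2_bounded (r%:C%C *: a).
  by rewrite scalerA; exact: ha.
have : invertible (1 - (b * a) ^+ (2 ^ m)).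
  apply: (invertible_near1 bn); rewrite opprB addrC subrK.
  have -> : b * a = (r%:C%C^-1 *: b) * (r%:C%C *: a).
    by rewrite -scalerAl -scalerAr scalerA mulVf // scale1r.
  rewrite exprMn; apply: (le_trans (nm_mul _ bn _ _)).
  apply: (le_trans (ler_piMr (nm_ge0 bn _) hm)).
  have [n' ->] : exists n', (2 ^ m = n'.+1)%N.
    by exists (2 ^ m).-1; rewrite prednK // expn_gt0.
  apply: (le_trans (nmXS bn _ _)).
  have h : nm (r%:C%C^-1 *: b) <= 2^-1.
    rewrite (nm_scale _ bn) normcV normcR gtr0_norm // mulrC ler_pdivrMr //.
    by rewrite /r; lra.
  rewrite exprS; apply: (le_trans _ h); apply: ler_piMr; first exact: nm_ge0 bn _.
  by apply: exprn_ile1; [exact: nm_ge0 bn _ | lra].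
rewrite -opprB subrX1 -mulNr opprB; exact: invertibleMl.
Qed.

End SpectralRadius.

(** * The separating space of a derivation and the gliding hump *)

Section SeparatingSpace.
Context {R : realType} {B : comAlgType R[i]} {nm : B -> R}.
Hypothesis bn : banach_norm nm.
Context {D : {linear B -> B}}.
Hypothesis derD : forall x y, D (x * y) = D x * y + x * D y.
Implicit Types (x y z a b s u v w : B) (k l : R[i]) (r c t : R).

(** The limits of [D x] along [x -> 0]: they are all zero exactly when the graph of [D] is
    closed. *)
Definition separating_space s := forall e, 0 < e ->
  exists x, nm x <= e /\ nm (D x - s) <= e.

(* Modulo the ideal generated by [s - l], which is bounded away from [1], the element
   [T * D x] is [c * D x] with [D x] close to a large multiple of [l]. *)
Lemma separating_hump s l k (T g v : B) (d r : R) : separating_space s ->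
  ~ invertible (s - l *: 1) -> l != 0 -> k != 0 -> T = k *: 1 + (s - l *: 1) * g ->
  0 < d -> exists x, nm x <= d /\
    forall w, nm w <= 2 -> r < nm (D (v + T * x + T * (s - l *: 1) * w)).
Proof.
set u := s - l *: 1 => sep ninv l0 k0 ET d0.
(* If [nm Z <= r], then [K] bounds every term of [E] below except the one with [D y - s]; [M] is
   chosen so that the scalar [kM * l] dominates them all. *)
pose K := `|r| + nm (D v) + nm (D T) * d + nm (D (T * u)) * 2.
have K0 : 0 <= K.
  by rewrite !addr_ge0 ?mulr_ge0 ?(nm_ge0 bn) ?normr_ge0 // ltW.
have lgt := normc_gt0 _ l0; have kgt := normc_gt0 _ k0.
pose M := 4 * (K + 1) / (normc k * normc l).
have M0 : 0 < M by rewrite !mulr_gt0 ?invr_gt0 ?mulr_gt0 //; lra.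
have ME : M * (normc k * normc l) = 4 * (K + 1).
  by rewrite divfK // gt_eqF // mulr_gt0.
have [|y [ny nDy]] := sep (Num.min (d / M) (normc l / 4)).
  by rewrite lt_min; apply/andP; split; apply: divr_gt0.
have {}ny : M * nm y <= d.
  by move: ny; rewrite le_min => /andP[h _]; rewrite mulrC -ler_pdivlMr.
have {}nDy : nm (D y - s) <= normc l / 4.
  by move: nDy; rewrite le_min => /andP[].
exists (M%:C%C *: y); split.
  by rewrite (nm_scale _ bn) normcR gtr0_norm.
(* If the image stayed small, a nonzero scalar would be close to a multiple of [u], and [u] would be
   invertible. *)
move=> w nw; rewrite ltNge; apply/negP => nZ; apply: ninv.
set Z := D _ in nZ.
pose kM := k * M%:C%C.
have kMn : normc kM = normc k * M by rewrite normcM normcR gtr0_norm.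
have kM0 : kM * l != 0.
  by rewrite !mulf_neq0 //; apply/eqP => -[]; lra.
pose q := T * D w + g * (M%:C%C *: D y) + kM *: 1.
have E : (kM * l) *: 1 + u * q =
    Z - D v - D T * (M%:C%C *: y) - D (T * u) * w - kM *: (D y - s).
  have -> : Z = D v + (D T * (M%:C%C *: y) + T * (M%:C%C *: D y)) +
      (D (T * u) * w + T * u * D w).
    by rewrite /Z !linearD /= (derD T) (derD (T * u)) linearZ.
  rewrite [X in D T * _ + X * _]ET /q.
  have -> : kM *: (D y - s) = kM *: D y - (kM * l) *: 1 - kM *: u.
    by rewrite -scalerA -!scalerBr /u; congr (_ *: _); ring.
  have -> : kM *: D y = k *: (M%:C%C *: D y) by rewrite scalerA.
  have -> : k *: (M%:C%C *: D y) = k *: 1 * (M%:C%C *: D y) by rewrite -scalerAl mul1r.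
  have -> : kM *: u = u * (kM *: 1) by rewrite -scalerAr mulr1.
  by ring.
have nE : nm ((kM * l) *: 1 + u * q) <= normc (kM * l) / 2.
  rewrite E.
  have h1 := nmB bn (Z - D v - D T * (M%:C%C *: y) - D (T * u) * w) (kM *: (D y - s)).
  have h2 := nmB bn (Z - D v - D T * (M%:C%C *: y)) (D (T * u) * w).
  have h3 := nmB bn (Z - D v) (D T * (M%:C%C *: y)).
  have h4 := nmB bn Z (D v).
  have h5 := nm_mul _ bn (D T) (M%:C%C *: y).
  have h6 := nm_mul _ bn (D (T * u)) w.
  rewrite !(nm_scale _ bn) kMn normcR (gtr0_norm M0) in h1 h5.
  have h7 := ler_wpM2l (nm_ge0 bn (D T)) ny.
  have h8 := ler_wpM2l (nm_ge0 bn (D (T * u))) nw.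
  have h9 : normc k * M * nm (D y - s) <= normc k * M * (normc l / 4).
    by rewrite ler_wpM2l // mulr_ge0 // ltW.
  have h10 := ler_norm r.
  rewrite normcM kMn; rewrite /K in ME; lra.
apply: (@invertibleMl _ _ (- (kM * l)^-1 *: q)).
apply: (invertible_near1 bn).
have -> : 1 - u * (- (kM * l)^-1 *: q) = (kM * l)^-1 *: ((kM * l) *: 1 + u * q).
  rewrite scaleNr mulrN opprK [RHS]scalerDr [X in _ = X + _]scalerA.
  by rewrite mulVf // scale1r scalerAr.
rewrite (nm_scale _ bn) normcV mulrC ler_pdivrMr ?normc_gt0 //.
by rewrite [leRHS]mulrC.
Qed.

(** Modulo [s - l *: 1] one may replace [s] by [l]; this is the form of [T] that [separating_hump]
    takes. *)
Lemma prod_sub_scalar_mod s l (mu : nat -> R[i]) n : exists g,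
  \prod_(0 <= i < n) (s - mu i *: 1) =
  (\prod_(0 <= i < n) (l - mu i)) *: 1 + (s - l *: 1) * g.
Proof.
elim: n => [|n [g ih]].
  by exists 0; rewrite !big_geq // scale1r mulr0 addr0.
rewrite !big_nat_recr //= ih; set p := \prod_(_ <= _ < _) _.
exists (p *: 1 + g * (s - mu n *: 1)).
have -> : (p * (l - mu n)) *: (1 : B) = p *: 1 * (l *: 1 - mu n *: 1).
  by rewrite -scalerBl -scalerAl mul1r scalerA.
by ring.
Qed.

(** Otherwise there are infinitely many spectral values [mu n], and humps [x n] are summed to [z]
    with weights [P 0 n]. Each hump gives [nm (D z) > n] whatever follows, since the later terms sum
    to [P 0 n.+1 * w] with [nm w <= 2]. *)
Lemma separating_finite_spectrum s : separating_space s ->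
  exists S : seq R[i], forall l, ~ invertible (s - l *: 1) -> l \in S.
Proof.
move=> sep; apply: contrapT => /forallNP hS.
have {}hS (S : seq R[i]) : exists l, ~ invertible (s - l *: 1) /\ l \notin S.
  have /existsNP[l /not_implyP[h1 /negP h2]] := hS S.
  by exists l.
have [f hf] := choice hS.
(* [ls n] lists the values already chosen; avoiding [0 :: ls n] makes the next one new and
   nonzero. *)
pose ls := fix ls n := if n is m.+1 then f (0 :: ls m) :: ls m else [::].
pose mu n := f (0 :: ls n).
have mu_ls n i : (i < n)%N -> mu i \in ls n.
  elim: n => // n ih; rewrite ltnS leq_eqVlt => /orP[/eqP->|/ih h] /=.
    by rewrite in_cons eqxx.
  by rewrite in_cons h orbT.
have mu_ninv n : ~ invertible (s - mu n *: 1) := (hf _).1.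
have mu0 n : mu n != 0.
  by have := (hf (0 :: ls n)).2; rewrite in_cons negb_or => /andP[].
have mu_neq n i : (i < n)%N -> mu n - mu i != 0.
  move=> /mu_ls h; rewrite subr_eq0; apply: contraNneq (hf (0 :: ls n)).2 => e.
  by rewrite in_cons -/(mu n) e h orbT.
pose P m n := \prod_(m <= i < n) (s - mu i *: 1).
(* A bound on every [P m n], so that humps of norm at most [(2 ^+ n * G n)^-1] stay summable after
   any factor [P 0 m] is taken out. *)
pose G n := nm 1 * \prod_(0 <= i < n) (1 + nm (s - mu i *: 1)).
have N1 := nm1_ge1 bn.
have GS n : G n <= G n.+1.
  rewrite /G big_nat_recr //= mulrA -[leLHS]mulr1; apply: ler_wpM2l.
    rewrite mulr_ge0 ?(nm_ge0 bn) // prodr_ge0 // => i _.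
    by rewrite addr_ge0 // (nm_ge0 bn).
  by rewrite lerDl (nm_ge0 bn).
have GN n : nm 1 <= G n.
  elim: n => [|n ih]; first by rewrite /G big_geq // mulr1.
  exact: le_trans ih (GS n).
have G1 n : 1 <= G n := le_trans N1 (GN n).
have PG m n : nm (P m n) <= G n.
  elim: n => [|n ih]; first by rewrite /P /G !big_geq // mulr1.
  case: (leqP m n) => hmn; last first.
    by rewrite /P big_geq.
  rewrite /P big_nat_recr //=; apply: (le_trans (nm_mul _ bn _ _)).
  rewrite /G big_nat_recr //= mulrA.
  by apply: ler_pM; rewrite ?(nm_ge0 bn) // lerDr.
have hump n v : exists x, nm x <= (2 ^+ n * G n)^-1 /\
    forall w, nm w <= 2 -> n%:R < nm (D (v + P 0%N n * x + P 0%N n.+1 * w)).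
  have [g hg] := prod_sub_scalar_mod s (mu n) mu n.
  rewrite /P (@big_nat_recr _ _ _ n) //=.
  apply: (separating_hump _ _ _ _ _ _ _ _ sep (mu_ninv n) (mu0 n) _ hg).
    by rewrite big_mkord; apply/prodf_neq0 => i _; apply: mu_neq.
  by rewrite invr_gt0 mulr_gt0 ?exprn_gt0 // (lt_le_trans ltr01).
have [X hX] := choice (fun p : nat * B => hump p.1 p.2).
pose v := fix v n := if n is m.+1 then v m + P 0%N m * X (m, v m) else 0.
pose x n := X (n, v n).
have nx n : nm (x n) <= (2 ^+ n * G n)^-1 := (hX (n, v n)).1.
have nPx m n : nm (P m n * x n) <= 1 / 2 ^+ n.
  apply: (le_trans (nm_mul _ bn _ _)).
  apply: (le_trans (ler_pM (nm_ge0 bn _) (nm_ge0 bn _) (PG m n) (nx n))).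
  by rewrite invfM mulrCA mulfV ?mulr1 ?div1r // gt_eqF // (lt_le_trans ltr01).
have [z hz] := nm_complete _ bn _ 1 (nPx 0%N).
have vE n : \sum_(i < n) (P 0%N i * x i) = v n.
  by elim: n => [|n ih]; rewrite ?big_ord0 // big_ord_recr /= ih.
(* All terms from the [n]-th on are divisible by [P 0 n], and the quotients are dominated by
   [1 / 2 ^+ i]. *)
have zE n : exists w, nm w <= 2 /\ z = v n + P 0%N n * w.
  have hu i : nm (P n (n + i)%N * x (n + i)%N) <= 1 / 2 ^+ i.
    apply: (le_trans (nPx _ _)); rewrite ler_pM2l // lef_pV2 ?posrE ?exprn_gt0 //.
    by rewrite ler_weXn2l ?ler1n // leq_addl.
  have [w hw] := nm_complete _ bn _ 1 hu.
  exists w; split; first by have := hw 0%N; rewrite big_ord0 subr0 expr0 divr1 mulr1.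
  apply/eqP; rewrite -subr_eq0; apply/eqP/(nm_le0 bn).
  apply: (@le0_of_le_half_pow _ _ (2 + nm (P 0%N n) * 2)) => m.
  set W := \sum_(i < m) (P n (n + i)%N * x (n + i)%N) in hw.
  have vW : v (n + m)%N = v n + P 0%N n * \sum_(i < m) (P n (n + i)%N * x (n + i)%N).
    elim: m {W} => [|m ih]; first by rewrite addn0 big_ord0 mulr0 addr0.
    rewrite addnS /= ih big_ord_recr /= mulrDr addrA mulrA.
    have -> : P 0%N n * P n (n + m)%N = P 0%N (n + m)%N.
      by rewrite /P -big_cat_nat //= leq_addr.
    by rewrite -ih.
  have -> : z - (v n + P 0%N n * w) = (z - v (n + m)%N) -
      P 0%N n * (w - \sum_(i < m) (P n (n + i)%N * x (n + i)%N)).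
    by rewrite vW; ring.
  apply: (le_trans (nmB bn _ _)); rewrite [leRHS]mulrDl; apply: lerD.
    rewrite -vE; apply: (le_trans (hz _)); rewrite mulr1 ler_pM2l //.
    by rewrite lef_pV2 ?posrE ?exprn_gt0 // ler_weXn2l ?ler1n // leq_addl.
  apply: (le_trans (nm_mul _ bn _ _)); rewrite -mulrA ler_wpM2l ?(nm_ge0 bn) //.
  by have := hw m; rewrite mulr1.
pose n := (Num.trunc (nm (D z))).+1.
have [w [nw ez]] := zE n.+1.
have := (hX (n, v n)).2 w nw; rewrite -/(x n) -[v n + _]/(v n.+1) -ez => h.
by have := lt_trans h (truncnS_gt _); rewrite ltxx.
Qed.

End SeparatingSpace.

(** * Vanishing of the separating space under semisimplicity *)

Section SemisimpleSeparatingSpace.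
Context {R : realType} {B : comAlgType R[i]} {nm : B -> R}.
Hypothesis bn : banach_norm nm.
Hypothesis semisimple : forall a : B, (forall b, invertible (1 - b * a)) -> a = 0.
Context {D : {linear B -> B}}.
Hypothesis derD : forall x y, D (x * y) = D x * y + x * D y.
Implicit Types (x y z a b s u v w : B) (k l : R[i]) (r c t : R).

Lemma derivation_horner s (p : {poly R[i]}) :
  D (horner_alg s p) = horner_alg s p^`() * D s.
Proof.
have D1 : D 1 = 0.
  by have /eqP := derD 1 1; rewrite !mulr1 mul1r -subr_eq subrr eq_sym => /eqP.
elim/poly_ind: p => [|p c ih]; first by rewrite !raddf0 mul0r.
rewrite derivD derivM derivX derivC addr0 mulr1 !rmorphD !rmorphM /=.
rewrite horner_algX horner_algC linearD /= derD ih linearZ /= D1 scaler0.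
by ring.
Qed.

(** Spectral mapping: [1 - k *: p] splits into linear factors, and a root in [S] would also be a
    root of [p], forcing [1 = 0]. So each factor is invertible at [s]. *)
Lemma horner_alg_quasinilpotent s (S : seq R[i]) :
  (forall l, ~ invertible (s - l *: 1) -> l \in S) ->
  forall k, invertible
    (1 - k *: horner_alg s (\prod_(l <- undup (0 :: S)) ('X - l%:P))).
Proof.
move=> hS k; set p := \prod_(_ <- _) _.
have [->|k0] := eqVneq k 0; first by exists 1; rewrite scale0r subr0 mulr1.
(* The adjoined [0] keeps [p] non-constant even for empty [S], so that [1 - k *: p] is nonzero. *)
have sp : (1 < size p)%N.
  rewrite size_prod_XsubC ltnS lt0n size_eq0.
  by apply/eqP => h; have := mem_undup (0 :: S) 0; rewrite h in_cons eqxx.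
have hZ (c : R[i]) (f : {poly R[i]}) : horner_alg s (c *: f) = c *: horner_alg s f.
  by rewrite -mul_polyC rmorphM /= horner_algC mulr_algl.
have -> : 1 - k *: horner_alg s p = horner_alg s (1 - k *: p).
  by rewrite rmorphB rmorph1 /= hZ.
have [rs Ers] := closed_field_poly_normal (1 - k *: p).
have lc0 : lead_coef (1 - k *: p) != 0.
  rewrite lead_coef_eq0 subr_eq0; apply/eqP => /(congr1 (fun q : {poly _} => size q)).
  by rewrite size_scale // size_poly1 => h; rewrite -h in sp.
have hrs (z : R[i]) : z \in rs -> invertible (s - z *: 1).
  move=> zrs; apply: contrapT => /hS zS.
  have : (1 - k *: p).[z] = 0.
    apply/eqP; have : root (\prod_(z <- rs) ('X - z%:P)) z by rewrite root_prod_XsubC.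
    by rewrite Ers /root hornerZ => /eqP->; rewrite mulr0.
  have : p.[z] = 0.
    by apply/eqP; rewrite -/(root _ _) root_prod_XsubC mem_undup in_cons zS orbT.
  by rewrite hornerD hornerN hornerZ hornerC => ->; rewrite mulr0 subr0 => /eqP; rewrite oner_eq0.
rewrite Ers hZ rmorph_prod /= -mulr_algl.
apply: invertibleM.
  by exists ((lead_coef (1 - k *: p))^-1 *: 1); rewrite -scalerAl mul1r scalerA divff // scale1r.
rewrite big_seq; elim/big_ind: _ => [||z /hrs].
- by exists 1; rewrite mulr1.
- exact: invertibleM.
by rewrite rmorphB /= horner_algX horner_algC.
Qed.

(* By semisimplicity [s] is killed by a polynomial with simple roots. *)
Lemma separating_derivation_eq0 s : @separating_space _ _ nm D s -> D s = 0.
Proof.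
move=> /(separating_finite_spectrum bn derD)[S hS].
have qn := horner_alg_quasinilpotent s S hS.
set p := \prod_(_ <- _) _ in qn.
have ps : horner_alg s p = 0.
  by apply: semisimple; exact: (quasinilpotent_radical bn _ qn).
have sepp : separable_poly p by rewrite separable_prod_XsubC undup_uniq.
(* Evaluated at [s], the Bezout relation between [p] and its derivative makes the derivative
   invertible, because [p] kills [s]; and the derivative kills [D s]. *)
have /Bezout_eq1_coprimepP[[u v] /= uv] : coprimep p p^`() by move: sepp; rewrite unlock.
have := derivation_horner s p; rewrite ps raddf0 => /esym h.
have : horner_alg s (u * p + v * p^`()) * D s = D s.
  by rewrite uv rmorph1 mul1r.
by rewrite rmorphD !rmorphM /= ps mulr0 add0r -mulrA h mulr0 => <-.
Qed.

Lemma separating_spaceMl b s :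
  @separating_space _ _ nm D s -> @separating_space _ _ nm D (b * s).
Proof.
move=> sep e e0; pose K := nm b + nm (D b) + 1.
have b0 := nm_ge0 bn b; have Db0 := nm_ge0 bn (D b).
have K0 : 0 < K by rewrite /K; lra.
have [|x [nx nDx]] := sep (e / K); first exact: divr_gt0.
have eK : e / K * K = e by rewrite divfK // gt_eqF.
have eK0 : 0 < e / K by exact: divr_gt0.
set d := e / K in eK eK0 nx nDx; rewrite /K in eK.
have dDb := mulr_ge0 (ltW eK0) Db0; have db := mulr_ge0 (ltW eK0) b0.
exists (b * x); split.
  apply: (le_trans (nm_mul _ bn _ _)).
  by have := ler_wpM2l b0 nx; lra.
have -> : D (b * x) - b * s = D b * x + b * (D x - s) by rewrite derD; ring.
apply: (le_trans (nm_triangle _ bn _ _)).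
have h1 := nm_mul _ bn (D b) x; have h2 := nm_mul _ bn b (D x - s).
have h3 := ler_wpM2l b0 nDx; have h4 := ler_wpM2l Db0 nx.
lra.
Qed.

(** [D] vanishes at [x * s] and at [s], hence [s * D x = 0]. Approximating [s] by values [D x] gives
    [s * s = 0], and nilpotents are radical. *)
Lemma separating_space_eq0 s : @separating_space _ _ nm D s -> s = 0.
Proof.
move=> sep.
have sD x : s * D x = 0.
  have := separating_derivation_eq0 _ (separating_spaceMl x s sep).
  by rewrite derD (separating_derivation_eq0 _ sep) mulr0 addr0 mulrC.
have s2 : s * s = 0.
  apply: (nm_le0 bn); apply: le0_of_le_eps => e e0.
  have s0 := nm_ge0 bn s.
  have [|x [_ hx]] := sep (e / (nm s + 1)); first by rewrite divr_gt0 //; lra.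
  have -> : s * s = s * (s - D x) by rewrite mulrBr sD subr0.
  apply: (le_trans (nm_mul _ bn _ _)); rewrite (nm_distC bn).
  apply: (le_trans (ler_wpM2l s0 hx)).
  by rewrite mulrCA ger_pMr // ler_pdivrMr ?mul1r; lra.
apply: semisimple => b; exists (1 + b * s).
have -> : (1 - b * s) * (1 + b * s) = 1 - b * b * (s * s) by ring.
by rewrite s2 mulr0 subr0.
Qed.

End SemisimpleSeparatingSpace.

(** * The closed graph theorem *)

Section ClosedGraph.
Context {R : realType} {B : comAlgType R[i]} {nm : B -> R}.
Hypothesis bn : banach_norm nm.
Context {D : {linear B -> B}}.
Hypothesis closedD : forall s, @separating_space _ _ nm D s -> s = 0.
Implicit Types (x y z a b s u v w : B) (k l : R[i]) (r c t : R).

(** Baire category for the sets where [nm (D v) <= n]: were none dense in a ball, nested balls with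
    [nm (D v) > n] on successive ones would share a point [z], and [nm (D z)] would exceed every
    [n]. *)
Lemma graph_approx_somewhere_dense : exists (n : nat) x r, 0 < r /\
  forall y, nm (y - x) <= r -> forall e, 0 < e ->
    exists v, nm (v - y) <= e /\ nm (D v) <= n%:R.
Proof.
apply: contrapT => hn.
have step (p : nat * (B * R)) : exists q : B * R, 0 < p.2.2 ->
   [/\ nm (q.1 - p.2.1) <= p.2.2 / 2, 0 < q.2 <= p.2.2 / 2 &
   forall v, nm (v - q.1) <= q.2 -> p.1%:R < nm (D v)].
  case: p => n [x r] /=; case: (ltP 0 r) => r0; last by exists (x, r).
  apply: contrapT => hq; apply: hn; exists n, x, (r / 2); split; first exact: divr_gt0.
  move=> y hy e e0; apply: contrapT => hv; apply: hq.
  exists (y, Num.min e (r / 2)) => _ /=; split => //.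
    by rewrite ge_min lexx orbT andbT lt_min e0 divr_gt0.
  move=> v; rewrite le_min => /andP[h _]; rewrite ltNge; apply/negP => h'.
  by apply: hv; exists v.
have [f hf] := choice step.
pose q := fix q n := if n is m.+1 then f (m, q m) else (0, 1 : R).
have r0 n : 0 < (q n).2.
  by elim: n => [|n ih] //=; have [_ /andP[]] := hf (n, q n) ih.
have hq n := hf (n, q n) (r0 n).
have rn n m : (q (n + m)%N).2 <= (q n).2 / 2 ^+ m.
  elim: m => [|m ih]; first by rewrite addn0 expr0 divr1.
  rewrite addnS exprSr invfM mulrA; have [_ /andP[_ h] _] := hq (n + m)%N.
  by apply: (le_trans h); rewrite ler_pM2r.
have hu n : nm ((q n.+1).1 - (q n).1) <= 1 / 2 ^+ n.
  have [h _ _] := hq n; apply: (le_trans h); have := rn 0%N n; rewrite add0n /=.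
  by have := r0 n; lra.
have [z hz] := nm_complete _ bn _ _ hu.
have tele n : \sum_(i < n) ((q i.+1).1 - (q i).1) = (q n).1.
  elim: n => [|n ih]; first by rewrite big_ord0.
  by rewrite big_ord_recr ih /= addrC subrK.
(* Each new centre lies within half the old radius and the radius at least halves, so the limit
   stays in every closed ball. *)
have cauchy n m : nm ((q (n + m)%N).1 - (q n).1) <= (q n).2 * (1 - (2 ^+ m)^-1).
  elim: m => [|m ih]; first by rewrite addn0 subrr (nm0 bn) expr0 invr1 subrr mulr0.
  have -> : (q (n + m.+1)%N).1 - (q n).1 =
      ((q (n + m).+1).1 - (q (n + m)%N).1) + ((q (n + m)%N).1 - (q n).1).
    by rewrite addnS; ring.
  apply: (le_trans (nm_triangle _ bn _ _)).
  have [h1 _ _] := hq (n + m)%N; have h2 := rn n m.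
  rewrite exprSr invfM; rewrite -[(n + m, q (n + m)).2.1]/(q (n + m)%N).1 in h1.
  by move: h1 ih h2; rewrite /=; set t := (2 ^+ m)^-1; nra.
have zq n : nm (z - (q n).1) <= (q n).2.
  rewrite -subr_le0; apply: (@le0_of_le_half_pow _ _ 2) => m.
  have -> : z - (q n).1 = (z - (q (n + m)%N).1) + ((q (n + m)%N).1 - (q n).1) by ring.
  have h1 := nm_triangle _ bn (z - (q (n + m)%N).1) ((q (n + m)%N).1 - (q n).1).
  have h2 := cauchy n m; have := hz (n + m)%N; rewrite tele mulr1 => h3.
  have h4 : (2 : R) / 2 ^+ (n + m) <= 2 / 2 ^+ m.
    by rewrite ler_pM2l // lef_pV2 ?posrE ?exprn_gt0 // ler_weXn2l ?ler1n // leq_addl.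
  have h5 : 0 <= (q n).2 * (2 ^+ m)^-1 by rewrite mulr_ge0 ?ltW ?invr_ge0 // exprn_ge0.
  by rewrite mulrBr mulr1 in h2; lra.
pose n := (Num.trunc (nm (D z))).+1.
have [_ _ /(_ z (zq n.+1))] := hq n.
by move=> /lt_trans/(_ (truncnS_gt _)); rewrite ltxx.
Qed.

(** Subtracting approximants of [x0] from approximants near [x0] moves the dense ball to the origin;
    scaling by [r / nm x] then handles every nonzero [x]. *)
Lemma graph_approx : exists c, 0 <= c /\ forall x, forall e, 0 < e ->
  exists v, nm (x - v) <= e /\ nm (D v) <= c * nm x.
Proof.
have [n [x0 [r [r0 h]]]] := graph_approx_somewhere_dense.
exists (2 * n%:R / r); split; first by rewrite divr_ge0 ?mulr_ge0 ?ler0n // ltW.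
move=> x e e0; have [/eqP x0'|xn0] := eqVneq (nm x) 0.
  exists 0; rewrite [D 0]linear0 (nm0 bn) (eqP x0') mulr0 lexx; split => //.
  by rewrite (nm_definite _ bn _ (eqP x0')) subr0 (nm0 bn) ltW.
have nx : 0 < nm x by rewrite lt0r xn0 (nm_ge0 bn).
pose k := r / nm x; have k0 : 0 < k by exact: divr_gt0.
have kC : k%:C%C != 0 :> R[i] by apply/eqP => -[]; lra.
have e'0 : 0 < e * k / 2 by rewrite divr_gt0 // mulr_gt0.
have [|v1 [h1 d1]] := h (x0 + k%:C%C *: x) _ _ e'0.
  rewrite addrC addKr (nm_scale _ bn) normcR gtr0_norm // /k divfK //.
have [|v2 [h2 d2]] := h x0 _ _ e'0; first by rewrite subrr (nm0 bn) ltW.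
exists (k%:C%C^-1 *: (v1 - v2)); split.
  have -> : x - k%:C%C^-1 *: (v1 - v2) =
     k%:C%C^-1 *: (- ((v1 - (x0 + k%:C%C *: x)) - (v2 - x0))).
    rewrite -[x in LHS]scale1r -(mulVf kC) -scalerA -scalerBr.
    by congr (_ *: _); ring.
  rewrite (nm_scale _ bn) normcV normcR gtr0_norm // (nmN bn).
  rewrite mulrC ler_pdivrMr //.
  by have := nmB bn (v1 - (x0 + k%:C%C *: x)) (v2 - x0); lra.
rewrite linearZ /= linearB (nm_scale _ bn) normcV normcR gtr0_norm //.
rewrite mulrC ler_pdivrMr //.
have -> : 2 * n%:R / r * nm x * k = 2 * n%:R.
  by rewrite /k; field; rewrite !gt_eqF.
by have := nmB bn (D v1) (D v2); lra.
Qed.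

(** Successive approximation makes [x] the sum of the [v n], with the [D (v n)] summing to some [l].
    The remainders [y n] tend to zero while [D (y n)] tends to [D x - l], which is therefore in the
    separating space. *)
Lemma closed_graph_bounded : exists c, 0 <= c /\ forall x, nm (D x) <= c * nm x.
Proof.
have [c [c0 hc]] := graph_approx; exists (2 * c); split; first by rewrite mulr_ge0.
move=> x; have [/eqP x0|xn0] := eqVneq (nm x) 0.
  by rewrite (nm_definite _ bn _ (eqP x0)) [D 0]linear0 !(nm0 bn) mulr0.
have nx : 0 < nm x by rewrite lt0r xn0 (nm_ge0 bn).
have step (p : nat * B) : exists v, nm (p.2 - v) <= nm x / 2 ^+ p.1.+1 /\
    nm (D v) <= c * nm p.2.
  by apply: hc; rewrite divr_gt0 // exprn_gt0.
have [f hf] := choice step.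
pose y := fix y n := if n is m.+1 then y m - f (m, y m) else x.
pose v n := f (n, y n).
have ny n : nm (y n) <= nm x / 2 ^+ n.
  by case: n => [|n] /=; [rewrite expr0 divr1|exact: (hf (n, y n)).1].
have nDv n : nm (D (v n)) <= c * nm x / 2 ^+ n.
  by apply: (le_trans (hf (n, y n)).2); rewrite -mulrA ler_wpM2l //= ny.
have sumv n : \sum_(i < n) v i = x - y n.
  elim: n => [|n ih]; first by rewrite big_ord0 subrr.
  by rewrite big_ord_recr ih /= -/(v n); ring.
have [l hl] := nm_complete _ bn _ _ nDv.
have sD n : \sum_(i < n) D (v i) = D x - D (y n).
  by rewrite -linear_sum sumv linearB.
have nl : nm l <= 2 * c * nm x.
  by have := hl 0%N; rewrite big_ord0 subr0 expr0 divr1 mulrA.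
suff : D x - l = 0 by move/eqP; rewrite subr_eq0 => /eqP->.
apply: closedD => e e0.
have [n hn] := exists_lt_expr2 ((nm x + 2 * (c * nm x)) / e).
exists (y n); have := hl n; rewrite sD => h.
have -> : D (y n) - (D x - l) = l - (D x - D (y n)) by ring.
have cx : 0 <= c * nm x by rewrite mulr_ge0 // ltW.
have p0 : (0 : R) < 2 ^+ n by rewrite exprn_gt0.
have hn' : (nm x + 2 * (c * nm x)) / 2 ^+ n <= e.
  by rewrite ler_pdivrMr // [leRHS]mulrC -ler_pdivrMr // ltW.
split; [apply: (le_trans (ny n))|apply: (le_trans h)]; apply: le_trans hn'.
  by rewrite ler_pM2r ?invr_gt0 //; lra.
by rewrite ler_pM2r ?invr_gt0 //; lra.
Qed.

End ClosedGraph.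

(** * Commutators and the vanishing of derivations *)

Section SemisimpleDerivation.
Context {R : realType} {B : comAlgType R[i]} {nm : B -> R}.
Hypothesis bn : banach_norm nm.
Context {D : {linear B -> B}}.
Hypothesis derD : forall x y, D (x * y) = D x * y + x * D y.
Implicit Types (x y z a b s u v w : B) (k l : R[i]) (r c t : R) (E : B -> B).

Let ad a E := fun x => E (a * x) - a * E x.

(** [ad a] is a derivation for composition of linear operators and sends [D] to multiplication by
    [D a], which it then kills; two terms of the Leibniz expansion remain. *)
Lemma iter_ad_derivation a E (k : nat) : iter k.+1 (ad a) (fun x => D (E x)) =
  fun x => D (iter k.+1 (ad a) E x) + (D a * iter k (ad a) E x) *+ k.+1.
Proof.
elim: k => [|k ih]; apply/funext => x.
  by rewrite /= /ad linearB /= derD mulr1n; ring.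
rewrite iterS {}ih -[iter k.+2 _ _]/(ad a (iter k.+1 (ad a) E)).
have -> : iter k.+1 (ad a) E = ad a (iter k (ad a) E) by [].
move: (iter k (ad a) E) => F; set G := ad a F.
have key (b p q r t : B) m : p + (b * q) *+ m - a * (r + (b * t) *+ m) =
    p - (b * (q - a * t) + a * r) + (b * (q - a * t)) *+ m.+1.
  rewrite mulrS mulrBr mulrnBl mulrDr mulrnAr (mulrCA a b).
  move: (_ *+ m) (_ *+ m) => X Y; ring.
rewrite [ad a (ad a F)]/ad -/G linearB /= derD; exact: key.
Qed.

Lemma iter_ad_iter_derivation a n :
  iter n (ad a) (iter n D) = (fun x => (D a ^+ n * x) *+ n`!) /\
  iter n.+1 (ad a) (iter n D) = (fun=> 0).
Proof.
have adE n' : (iter n'.+1 D : B -> B) = (fun x => D (iter n' D x)) by [].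
elim: n => [|n [ih1 ih2]]; split; try apply/funext => x.
- by rewrite /= expr0 mul1r fact0 mulr1n.
- by rewrite /= /ad subrr.
- rewrite adE iter_ad_derivation ih2 ih1 linear0 add0r exprS.
  by rewrite factS mulnC mulrnA -mulrA mulrnAr.
- rewrite adE iter_ad_derivation iterS ih2 /ad mulr0 subr0 linear0.
  by rewrite mulr0 mul0rn addr0.
Qed.

(* Kleinecke-Shirokov: [n! (D a)^n] is the [n]-th iterated commutator of [D^n] with
   multiplication by [a], hence grows at most geometrically. *)
Lemma bounded_derivation_pow_le c a n : (forall x, nm (D x) <= c * nm x) -> 0 <= c ->
  nm (D a ^+ n) <= (2 * nm a * c) ^+ n / n`!%:R * nm 1.
Proof.
move=> hc c0; have a0 := nm_ge0 bn a.
have hD x : nm (iter n D x) <= c ^+ n * nm x.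
  elim: n => [|n ih]; first by rewrite expr0 mul1r.
  by apply: (le_trans (hc _)); rewrite exprS -mulrA ler_wpM2l //.
have had m x : nm (iter m (ad a) (iter n D) x) <= (2 * nm a) ^+ m * c ^+ n * nm x.
  elim: m x => [|m ih] x; first by rewrite expr0 mul1r; exact: hD.
  rewrite iterS {1}/ad; set F := iter m _ _ in ih *.
  apply: (le_trans (nmB bn _ _)).
  have h1 := ih (a * x); have h2 := nm_mul _ bn a x; have h3 := nm_mul _ bn a (F x).
  have h4 := ler_wpM2l a0 (ih x).
  have K0 : 0 <= (2 * nm a) ^+ m * c ^+ n.
    by apply: mulr_ge0; apply: exprn_ge0 => //; apply: mulr_ge0.
  have h5 := ler_wpM2l K0 h2.
  by rewrite exprS; lra.
have := had n 1; rewrite (iter_ad_iter_derivation a n).1 mulr1 -exprMn.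
rewrite -scaler_nat (nm_scale _ bn).
have -> : normc (n`!%:R : R[i]) = n`!%:R.
  by rewrite -[n`!%:R]mulr1n -(rmorph_nat (real_complex R)) normcR normr_nat.
by move=> h; rewrite [leRHS]mulrAC ler_pdivlMr ?ltr0n ?fact_gt0 // mulrC.
Qed.

(** The factorial makes some power of [d * D a] of norm at most one half, and [1 - d * D a] divides
    one minus that power; so [D a] is radical. *)
Lemma semisimple_derivation_eq0 :
  (forall a, (forall b, invertible (1 - b * a)) -> a = 0) -> forall a, D a = 0.
Proof.
move=> semisimple a.
have [c [c0 hc]] := closed_graph_bounded bn (separating_space_eq0 bn semisimple derD).
apply: semisimple => d.
have N1 := nm1_ge1 bn; have d0 := nm_ge0 bn d; have a0 := nm_ge0 bn a.
pose K := nm d * (2 * nm a * c).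
have K0 : 0 <= K by rewrite /K !mulr_ge0.
have e0 : 0 < (2 * (nm 1 * nm 1))^-1 by rewrite invr_gt0 !mulr_gt0 //; lra.
have [n hn] : exists n, K ^+ n / n`!%:R <= (2 * (nm 1 * nm 1))^-1.
  have := cvg_series_cvg_0 (is_cvg_series_exp_coeff K).
  move/cvgrPdist_le => /(_ _ e0) [n _ /(_ n (leqnn n))] /=.
  by rewrite sub0r normrN => /(le_trans (ler_norm _)) h; exists n.
suff : invertible (1 - (d * D a) ^+ n).
  rewrite -opprB subrX1 -mulNr opprB; exact: invertibleMl.
apply: (invertible_near1 bn); rewrite opprB addrC subrK exprMn.
apply: (le_trans (nm_mul _ bn _ _)).
have h1 := nmX bn d n; have h2 := bounded_derivation_pow_le c a n hc c0.
apply: (le_trans (ler_pM (nm_ge0 bn _) (nm_ge0 bn _) h1 h2)).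
have -> : nm 1 * nm d ^+ n * ((2 * nm a * c) ^+ n / n`!%:R * nm 1) =
  K ^+ n / n`!%:R * (nm 1 * nm 1) by rewrite /K [in RHS]exprMn; ring.
have N2 : 0 < nm 1 * nm 1 by rewrite mulr_gt0 //; lra.
by rewrite -ler_pdivlMr // -invfM.
Qed.

End SemisimpleDerivation.

(** * The real-valued norm and completeness *)

Section RealNorm.
Context {R : realType} {A : completeNormedModType R[i]}.
Implicit Types (x y : A) (k : R[i]).

(** The norm of [A] takes values in [R[i]]; this is the same number in [R]. *)
Definition real_norm x : R := complex.Re `|x|.

Lemma real_normE x : (real_norm x)%:C%C = `|x|.
Proof. by rewrite RRe_real // normr_real. Qed.

Lemma real_normD x y : real_norm (x + y) <= real_norm x + real_norm y.
Proof. by rewrite -lecR rmorphD /= !real_normE ler_normD. Qed.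

Lemma real_normN x : real_norm (- x) = real_norm x.
Proof. by rewrite /real_norm normrN. Qed.

Lemma real_norm0 : real_norm (0 : A) = 0.
Proof. by rewrite /real_norm normr0. Qed.

Lemma real_norm_eq0 x : real_norm x = 0 -> x = 0.
Proof. by move=> h; apply/normr0_eq0; rewrite -real_normE h. Qed.

Lemma real_normZ k x : real_norm (k *: x) = normc k * real_norm x.
Proof. by apply: (@complexI R); rewrite rmorphM /= !real_normE normrZ. Qed.

Lemma real_norm_ge0 x : 0 <= real_norm x.
Proof. by rewrite -lecR real_normE rmorph0. Qed.

Lemma geometric_series_cvg (u : nat -> A) c :
  (forall n, real_norm (u n) <= c / 2 ^+ n) ->
  exists l, forall n, real_norm (l - \sum_(i < n) u i) <= 2 * c / 2 ^+ n.
Proof.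
move=> hu; pose s n := \sum_(i < n) u i.
have c0 : 0 <= c by have := hu 0%N; rewrite expr0 divr1; apply: le_trans (real_norm_ge0 _).
have tail n m : real_norm (s (n + m)%N - s n) <= 2 * c / 2 ^+ n * (1 - (2 ^+ m)^-1).
  elim: m => [|m ih].
    by rewrite addn0 [X in real_norm X]subrr real_norm0 expr0 invr1 subrr mulr0.
  have -> : s (n + m.+1)%N - s n = u (n + m)%N + (s (n + m)%N - s n).
    by rewrite /s addnS big_ord_recr /= addrA (addrC (u _)).
  apply: (le_trans (real_normD _ _)).
  have h := hu (n + m)%N; rewrite exprD invfM in h.
  rewrite exprSr invfM; move: h ih.
  by set p := (2 ^+ n)^-1; set q := (2 ^+ m)^-1; lra.
have tail' n m : (n <= m)%N -> real_norm (s m - s n) <= 2 * c / 2 ^+ n.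
  move=> nm; rewrite -(subnKC nm); apply: (le_trans (tail _ _)).
  apply: ler_piMr; first by rewrite divr_ge0 ?mulr_ge0 ?exprn_ge0.
  by rewrite gerBl invr_ge0 exprn_ge0.
have /cauchy_cvg : cauchy (s @ \oo).
  apply: cauchy_exP => e e0.
  have eR : e = (complex.Re e)%:C%C by rewrite RRe_real // gtr0_real.
  have e'0 : 0 < complex.Re e by move: e0; rewrite {1}eR ltcR.
  have [n hn] := exists_lt_expr2 (2 * c / complex.Re e).
  exists (s n); exists n => // m nm /=.
  rewrite -ball_normE /= -real_normE eR ltcR -opprB real_normN.
  apply: (le_lt_trans (tail' n m nm)).
  by rewrite ltr_pdivrMr ?exprn_gt0 // [ltRHS]mulrC -ltr_pdivrMr.
move=> /cvg_ex[l hl]; exists l => n; rewrite -subr_le0; apply: le0_of_le_eps => e e0.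
have e0C : 0 < e%:C%C by rewrite ltcR.
have /cvgrPdist_le /(_ _ e0C)[N _ hN] := hl.
have := hN (maxn n N) (leq_maxr _ _) => /=; rewrite -real_normE lecR => h1.
have h2 := tail' n (maxn n N) (leq_maxl _ _).
have h3 := real_normD (l - s (maxn n N)) (s (maxn n N) - s n).
rewrite addrA subrK in h3; rewrite -/(s n); lra.
Qed.

End RealNorm.

(* For a right identity [e], the left multiplication by [e] is a projection with kernel
   the right annihilator, so [e A] is a copy of [A / rann A] inside [A]. *)
Record corner_data (R : realType) (A : completeNormedModType R[i]) := CornerData {
  cmul : A -> A -> A;
  cid : A;
  cmul_banach : banach_algebra cmul;
  cmulr1 : forall a, cmul a cid = a;
  cmul_comm : forall a b, cmul cid (cmul a b) = cmul cid (cmul b a);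
  cid_neq0 : cid != 0 }.

Record corner (R : realType) (A : completeNormedModType R[i]) (C : corner_data R A) :=
  Corner { cval : A; cvalP : cmul _ _ C (cid _ _ C) cval == cval }.
HB.instance Definition _ R A C := [isSub for @cval R A C].
HB.instance Definition _ R A C := [Choice of corner R A C by <:].

(** * The algebra structure on [e A] *)

Section Corner.
Context {R : realType} {A : completeNormedModType R[i]} {C : corner_data R A}.
Local Notation "a ** b" := (cmul _ _ C a b) (at level 40, left associativity).
Local Notation e := (cid _ _ C).
Local Notation B := (corner R A C).
Implicit Types (a b : A) (x y z : B) (k : R[i]).

Lemma cmulA a b c : a ** (b ** c) = a ** b ** c.
Proof. by have [-> _] := cmul_banach _ _ C. Qed.
Lemma cmulDl a b c : (a + b) ** c = a ** c + b ** c.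
Proof. by have [_ [[-> _ _ _] _]] := cmul_banach _ _ C. Qed.
Lemma cmulDr a b c : a ** (b + c) = a ** b + a ** c.
Proof. by have [_ [[_ -> _ _] _]] := cmul_banach _ _ C. Qed.
Lemma cmulZl k a b : (k *: a) ** b = k *: (a ** b).
Proof. by have [_ [[_ _ -> _] _]] := cmul_banach _ _ C. Qed.
Lemma cmulZr k a b : a ** (k *: b) = k *: (a ** b).
Proof. by have [_ [[_ _ _ ->] _]] := cmul_banach _ _ C. Qed.
Lemma cmul_norm a b : `|a ** b| <= `|a| * `|b|.
Proof. by have [_ [_ ->]] := cmul_banach _ _ C. Qed.
Lemma cmulNr a b : a ** (- b) = - (a ** b).
Proof. by rewrite -scaleN1r cmulZr scaleN1r. Qed.
Lemma cmulNl a b : (- a) ** b = - (a ** b).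
Proof. by rewrite -scaleN1r cmulZl scaleN1r. Qed.
Lemma cmul0r a : a ** 0 = 0.
Proof. by have := cmulZr 0 a 0; rewrite !scale0r. Qed.
Lemma cid_cval x : e ** cval _ _ _ x = cval _ _ _ x.
Proof. exact/eqP/cvalP. Qed.

Lemma cproj_subproof a : e ** (e ** a) == e ** a.
Proof. by rewrite cmulA cmulr1. Qed.
(** This also serves as the quotient map by the right annihilator, its kernel. *)
Definition cproj a : B := Corner _ _ _ _ (cproj_subproof a).

Lemma cvalK x : cproj (cval _ _ _ x) = x.
Proof. by apply: val_inj; exact: cid_cval. Qed.

(** Projecting every result makes membership in the corner automatic; on these values the projection
    changes nothing. *)
Definition corner_zero : B := cproj 0.
Definition corner_one : B := cproj e.
Definition corner_opp x : B := cproj (- cval _ _ _ x).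
Definition corner_add x y : B := cproj (cval _ _ _ x + cval _ _ _ y).
Definition corner_mul x y : B := cproj (cval _ _ _ x ** cval _ _ _ y).
Definition corner_scale k x : B := cproj (k *: cval _ _ _ x).

Let valE := (cmulDr, cmulNr, cmulZr, cmul0r, cmulA, cmulr1, cid_cval).

Lemma corner_addA : associative corner_add.
Proof. by move=> x y z; apply: val_inj; rewrite /= !valE addrA. Qed.
Lemma corner_addC : commutative corner_add.
Proof. by move=> x y; apply: val_inj; rewrite /= addrC. Qed.
Lemma corner_add0 : left_id corner_zero corner_add.
Proof. by move=> x; apply: val_inj; rewrite /= !valE add0r. Qed.
Lemma corner_addN : left_inverse corner_zero corner_opp corner_add.
Proof. by move=> x; apply: val_inj; rewrite /= !valE addNr. Qed.
HB.instance Definition _ :=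
  GRing.isZmodule.Build B corner_addA corner_addC corner_add0 corner_addN.

Lemma corner_mulA : associative corner_mul.
Proof. by move=> x y z; apply: val_inj; rewrite /= !valE. Qed.
Lemma corner_mulC : commutative corner_mul.
Proof. by move=> x y; apply: val_inj; exact: cmul_comm. Qed.
Lemma corner_mul1 : left_id corner_one corner_mul.
Proof. by move=> x; apply: val_inj; rewrite /= !valE. Qed.
Lemma corner_mulDl : left_distributive corner_mul corner_add.
Proof. by move=> x y z; apply: val_inj; rewrite /= !valE cmulDl. Qed.
Lemma corner_one_neq0 : corner_one != 0.
Proof.
by apply/eqP => /(congr1 val); rewrite /= !valE; apply/eqP; exact: cid_neq0.
Qed.
HB.instance Definition _ := GRing.Zmodule_isComNzRing.Build B
  corner_mulA corner_mulC corner_mul1 corner_mulDl corner_one_neq0.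

Lemma corner_scaleA k l x :
  corner_scale k (corner_scale l x) = corner_scale (k * l) x.
Proof. by apply: val_inj; rewrite /= !valE scalerA. Qed.
Lemma corner_scale1 : left_id 1 corner_scale.
Proof. by move=> x; apply: val_inj; rewrite /= !valE scale1r. Qed.
Lemma corner_scaleDr : right_distributive corner_scale corner_add.
Proof. by move=> k x y; apply: val_inj; rewrite /= !valE scalerDr. Qed.
Lemma corner_scaleDl x k l :
  corner_scale (k + l) x = corner_add (corner_scale k x) (corner_scale l x).
Proof. by apply: val_inj; rewrite /= !valE scalerDl. Qed.
HB.instance Definition _ := GRing.Zmodule_isLmodule.Build R[i] B
  corner_scaleA corner_scale1 corner_scaleDr corner_scaleDl.

Lemma corner_scaleAl k x y :
  corner_scale k (corner_mul x y) = corner_mul (corner_scale k x) y.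
Proof. by apply: val_inj; rewrite /= !valE cmulZl ?valE. Qed.
HB.instance Definition _ := GRing.Lmodule_isLalgebra.Build R[i] B corner_scaleAl.
HB.instance Definition _ := GRing.Lalgebra_isComAlgebra.Build R[i] B.

End Corner.

(** * Transfer between [A] and the corner *)

Section CornerTheory.
Context {R : realType} {A : completeNormedModType R[i]} {C : corner_data R A}.
Local Notation mul := (cmul _ _ C).
Local Notation "a ** b" := (cmul _ _ C a b) (at level 40, left associativity).
Local Notation e := (cid _ _ C).
Local Notation B := (corner R A C).
Local Notation val := (cval R A C).
Implicit Types (a b : A) (x y z : B) (k : R[i]).

Lemma cval_inj : injective val.
Proof. exact: val_inj. Qed.

Lemma cidK a : e ** (e ** a) = e ** a.
Proof. by rewrite cmulA cmulr1. Qed.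

Lemma cvalD x y : val (x + y) = val x + val y.
Proof. by rewrite -[x + y]/(corner_add x y) /= cmulDr !cid_cval. Qed.

Lemma cvalN x : val (- x) = - val x.
Proof. by rewrite -[- x]/(corner_opp x) /= cmulNr !cid_cval. Qed.

Lemma cvalM x y : val (x * y) = val x ** val y.
Proof. by rewrite -[x * y]/(corner_mul x y) /= cmulA !cid_cval. Qed.

Lemma cvalZ k x : val (k *: x) = k *: val x.
Proof. by rewrite -[k *: x]/(corner_scale k x) /= cmulZr !cid_cval. Qed.

Lemma cval0 : val 0 = 0.
Proof. by rewrite -[0 : B]/(corner_zero) /= cmul0r. Qed.

Lemma cval_sum n (u : nat -> B) : val (\sum_(i < n) u i) = \sum_(i < n) val (u i).
Proof. exact: (big_morph _ cvalD cval0). Qed.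

Lemma cprojD a b : cproj (a + b) = cproj a + cproj b :> B.
Proof. by apply: cval_inj; rewrite cvalD /= cmulDr. Qed.

Lemma cprojN a : cproj (- a) = - cproj a :> B.
Proof. by apply: cval_inj; rewrite cvalN /= cmulNr. Qed.

Lemma cprojM a b : cproj (a ** b) = cproj a * cproj b :> B.
Proof. by apply: cval_inj; rewrite cvalM /= !cmulA cmulr1. Qed.

Lemma cprojZ k a : cproj (k *: a) = k *: cproj a :> B.
Proof. by apply: cval_inj; rewrite cvalZ /= cmulZr. Qed.

Lemma cproj0 : cproj 0 = 0 :> B.
Proof. by []. Qed.

Lemma cproj_cval x : cproj (val x) = x.
Proof. exact: cvalK. Qed.

Definition corner_norm x := real_norm (val x).

Lemma real_norm_cmul a b : real_norm (a ** b) <= real_norm a * real_norm b.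
Proof. by rewrite -lecR rmorphM /= !real_normE cmul_norm. Qed.

Lemma corner_banach_norm : banach_norm corner_norm.
Proof.
split=> [x y|k x|x y|x|u c hu]; rewrite /corner_norm.
- by rewrite cvalD real_normD.
- by rewrite cvalZ real_normZ.
- by rewrite cvalM real_norm_cmul.
- by move=> /real_norm_eq0 h; rewrite -(cproj_cval x) h.
have [l hl] := geometric_series_cvg (fun n => val (u n)) c hu.
(* Left multiplication by [e] is bounded, so the limit stays in the corner. *)
have el : e ** l = l.
  apply/eqP; rewrite -subr_eq0; apply/eqP/real_norm_eq0/eqP.
  rewrite eq_le real_norm_ge0 andbT.
  apply: (@le0_of_le_half_pow _ _ ((real_norm e + 1) * (2 * c))) => n.
  have h := hl n; rewrite -cval_sum in h; set s := \sum_(i < n) u i in h.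
  have -> : e ** l - l = e ** (l - val s) - (l - val s).
    by rewrite cmulDr cmulNr cid_cval opprB addrA subrK.
  apply: (le_trans (real_normD _ _)); rewrite real_normN -mulrA mulrDl mul1r.
  apply: lerD => //; apply: (le_trans (real_norm_cmul _ _)).
  by rewrite ler_wpM2l // real_norm_ge0.
exists (cproj l) => n.
by rewrite cvalD cvalN cval_sum /= el; exact: hl.
Qed.

(** From [b = b ** e] one gets [b ** a = b ** (e ** a)], so [e] alone decides. *)
Lemma rann_cproj a : rann mul a <-> cproj a = 0 :> B.
Proof.
split=> h; first by apply: cval_inj; rewrite cval0; exact: h.
by move=> b; rewrite -[b](cmulr1 _ _ C) -cmulA -[e ** a]/(val (cproj a)) h cval0 cmul0r.
Qed.

Lemma quasi_invertible_cproj a :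
  quasi_invertible mul a <-> invertible (1 - cproj a : B).
Proof.
split=> [[b [h _]]|[y hy]].
  exists (1 - cproj b).
  have := congr1 (@cproj _ _ C) h; rewrite cproj0 !cprojD cprojN cprojM => {}h.
  have -> (p q : B) : (1 - p) * (1 - q) = 1 - (p + q - p * q) by ring.
  by rewrite h subr0.
(* [c] is a quasi-inverse only modulo the right annihilator. The witness [a ** c - a] has the same
   class, and its defects are left multiples by [a] of annihilated elements, hence zero. *)
pose c := val (1 - y); exists (a ** c - a).
have ey : y = 1 + cproj a * y by rewrite -hy; ring.
split.
  have -> : a + (a ** c - a) - a ** (a ** c - a) = a ** (c - a ** c + a).
    by rewrite [a + _]addrC subrK !cmulDr !cmulNr opprB addrA addrAC.
  apply: (rann_cproj _).2; rewrite !cprojD cprojN cprojM cproj_cval.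
  by rewrite {1}ey; ring.
have -> : a ** c - a + a - (a ** c - a) ** a = a ** (c - c ** a + a).
  rewrite subrK cmulDl cmulNl !cmulDr !cmulNr opprD opprK !cmulA addrA.
  by [].
apply: (rann_cproj _).2; rewrite !cprojD cprojN cprojM cproj_cval.
by rewrite {1}ey; ring.
Qed.

Lemma jacobson_rad_cproj a :
  jacobson_rad mul a <-> forall x, invertible (1 - x * cproj a).
Proof.
split=> h x; last by apply/quasi_invertible_cproj; rewrite cprojM.
by have /quasi_invertible_cproj := h (val x); rewrite cprojM cproj_cval.
Qed.

Lemma spectral_radius_eq0 a : spectral_radius mul a = 0 ->
  forall k, invertible (1 - k *: cproj a : B).
Proof.
have bn := corner_banach_norm.
move=> ra k; have [->|k0] := eqVneq k 0.
  by exists 1; rewrite scale0r subr0 mulr1.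
apply: contrapT => ninv.
have kspec : spectrum mul a k^-1.
  right; rewrite invr_eq0 invrK; split => //.
  by move=> /quasi_invertible_cproj; rewrite cprojZ.
have nE (l : R[i]) : complex.Re `|l| = normc l by [].
have : complex.Re `|k^-1| <= spectral_radius mul a.
  (* [sup] defaults to [0] on unbounded sets, so the spectrum has to be bounded first, by a Neumann
     series. *)
  apply: ub_le_sup; last by exists k^-1.
  exists (2 * corner_norm (cproj a)) => _ [l [->|[l0 hl]] <-]; rewrite nE.
    by rewrite normc0 mulr_ge0 // (nm_ge0 bn).
  rewrite leNgt; apply/negP => hlt; apply: hl.
  apply/quasi_invertible_cproj; rewrite cprojZ; apply: (invertible_near1 bn).
  rewrite opprB addrC subrK (nm_scale _ bn) normcV mulrC.
  by rewrite ler_pdivrMr ?normc_gt0 //; lra.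
by rewrite ra nE leNgt normc_gt0 // invr_eq0.
Qed.

Hypothesis rad_rann : jacobson_rad mul = rann mul.

Lemma corner_semisimple x : (forall y, invertible (1 - y * x)) -> x = 0.
Proof.
move=> h; have : jacobson_rad mul (val x).
  by apply/jacobson_rad_cproj; rewrite cproj_cval.
by rewrite rad_rann => /rann_cproj; rewrite cproj_cval.
Qed.

(** The compression of [d] to the corner is a derivation there, hence zero. The rest of [a], namely
    [a - e ** a], lies in the right annihilator, which [d] preserves. *)
Lemma derivation_in_rann (d : {linear A -> A}) : is_derivation mul d ->
  forall a, rann mul (d a).
Proof.
move=> derd a.
pose D x : B := cproj (d (val x)).
have Dlin : linear D.
  by move=> k x y; rewrite /D cvalD cvalZ linearP cprojD cprojZ.
pose D' : {linear B -> B} := HB.pack D (GRing.isLinear.Build _ _ _ _ D Dlin).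
have derD x y : D' (x * y) = D' x * y + x * D' y.
  by rewrite /= /D cvalM derd cprojD !cprojM !cproj_cval.
have D0 := semisimple_derivation_eq0 corner_banach_norm derD corner_semisimple.
(* Applying [d] to [e ** c = 0], where [d e ** c] vanishes as well, leaves [e ** d c = 0]. *)
have d_rann c : cproj c = 0 :> B -> cproj (d c) = 0 :> B.
  move=> hc; have rc := (rann_cproj c).2 hc.
  have := derd e c; rewrite rc linear0 rc add0r => h.
  by apply: cval_inj; rewrite cval0; exact: esym h.
apply/rann_cproj.
have -> : a = (a - e ** a) + e ** a by rewrite subrK.
rewrite linearD cprojD d_rann ?add0r; last first.
  by rewrite cprojD cprojN; apply/eqP; rewrite subr_eq0; apply/eqP/val_inj; rewrite /= cidK.
exact: (D0 (cproj a)).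
Qed.

End CornerTheory.

(** * The right annihilator and the three conditions *)

Section RightAnnihilator.
Context {R : realType} {A : completeNormedModType R[i]} (mul : A -> A -> A).

(** Products with a multiple of [a] on the right vanish, so each such multiple has its opposite as
    quasi-inverse. *)
Lemma rann_spectral_radius_eq0 a :
  banach_algebra mul -> rann mul a -> spectral_radius mul a = 0.
Proof.
move=> [_ [[_ _ _ mulZr] _]] ra; rewrite /spectral_radius.
suff -> : [set complex.Re `|l| | l in spectrum mul a] = [set 0] by exact: sup1.
have n0 : complex.Re `|0 : R[i]| = 0 by rewrite normr0.
apply/seteqP; split=> [_ [l [->|[l0 hl]] <-]|_ ->]; first exact: n0.
  case: hl; exists (- (l^-1 *: a)); rewrite -scaleNr.
  by split; rewrite mulZr ra scaler0 subr0 -scalerDl ?subrr ?addNr scale0r.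
by exists 0 => //; left.
Qed.

End RightAnnihilator.

Theorem theorem3p5 (R : realType) (A : completeNormedModType R[i])
  (mul : A -> A -> A) (delta d : {linear A -> A}) :
  banach_algebra mul ->
  jacobson_rad mul = rann mul ->
  quotient_by_rad_commutative mul ->
  has_right_identity mul ->
  is_generalized_derivation mul delta d ->
  ((forall a, jacobson_rad mul (delta a)) <-> spectrally_infinitesimal mul delta) /\
  (spectrally_infinitesimal mul delta <-> (forall a, delta a = d a)).
Proof.
move=> ba rad_rann qcomm [e mule] [derd gend].
have i_ii : (forall a, jacobson_rad mul (delta a)) -> spectrally_infinitesimal mul delta.
  by move=> h a; apply: rann_spectral_radius_eq0 => //; rewrite -rad_rann.
have i_iii : (forall a, jacobson_rad mul (delta a)) -> forall a, delta a = d a.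
  (* Expand [delta] at [mul a e]: the term containing [delta e] is annihilated. *)
  move=> h a; have := h e; rewrite rad_rann => he.
  by rewrite -[in LHS](mule a) gend he add0r mule.
(* If [e = 0] then [A] is zero and the corner is not a nontrivial ring. *)
have [e0|e0] := eqVneq e 0.
  have mula0 a : mul a 0 = 0.
    by have [_ [[_ _ _ h] _]] := ba; have := h 0 a 0; rewrite !scale0r.
  have A0 (a : A) : a = 0 by rewrite -(mule a) e0 mula0.
  have i a : jacobson_rad mul (delta a) by rewrite rad_rann => b; exact: A0.
  by split; split => // _; [exact: i_iii | exact: i_ii].
have mul_comm a b : mul e (mul a b) = mul e (mul b a).
  have := qcomm a b; rewrite rad_rann => /(_ e).
  have [_ [[_ mulDr _ mulZr] _]] := ba.
  by rewrite mulDr -scaleN1r mulZr scaleN1r => /eqP; rewrite subr_eq0 => /eqP.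
pose C := CornerData R A mul e ba mule mul_comm e0.
have ii_i : spectrally_infinitesimal mul delta -> forall a, jacobson_rad mul (delta a).
  move=> h a; apply/(@jacobson_rad_cproj _ _ C).
  apply: (quasinilpotent_radical corner_banach_norm).
  exact/spectral_radius_eq0/h.
have iii_i : (forall a, delta a = d a) -> forall a, jacobson_rad mul (delta a).
  by move=> h a; rewrite h rad_rann; exact: (@derivation_in_rann _ _ C rad_rann d derd).
split; split => //; first by move=> /ii_i.
by move=> /iii_i.
Qed.
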